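(* Let $\mathcal{C}$ be a finite and skeletal EI-category and $k$ a field such that $k\mathcal{C}$ is of finite representation type. Then the endotrivialisation $\widehat{\mathcal{C}}$ of $\mathcal{C}$ is (the category associated to) a finite poset of finite representation type over $k$.
   Context: An EI-category is a category in which every endomorphism is an isomorphism; it is finite if it has finitely many morphisms (hence finitely many objects), and skeletal if isomorphic objects are equal. For a finite category $\mathcal{C}$, the category algebra $k\mathcal{C}$ is the $k$-algebra with $k$-basis the set of morphisms of $\mathcal{C}$ and multiplication induced by composition (the product of two non-composable morphisms is $0$). A finite-dimensional $k$-algebra is of finite representation type if it has only finitely many isomorphism classes of finite-dimensional indecomposable modules. A finite poset $(X,\leq)$ is regarded as a category with object set $X$ and exactly one morphism $x\to y$ if $x\leq y$ and none otherwise; it is of finite representation type over $k$ if its category algebra (the incidence algebra) is. Endotrivialisation: for a finite skeletal EI-category $\mathcal{C}$, define a relation on the morphisms of $\mathcal{C}$ by $f\sim g$ if and only if there are morphisms $f'',f'$ and endomorphisms $h_1,h_2$ in $\mathcal{C}$ with $f=f''h_1f'$ and $g=f''h_2f'$. Denote the transitive hull of this (reflexive and symmetric) relation again by $\sim$; it is compatible with composition. Then $\widehat{\mathcal{C}}:=\mathcal{C}/\!\sim$ is the quotient category with the same objects as $\mathcal{C}$ and with $\sim$-classes of morphisms as morphisms; all its endomorphisms are identities. *)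

(* Defs.v *)
From HB Require Import structures.
From mathcomp Require Import all_boot all_order all_algebra.

Set Implicit Arguments.
Unset Strict Implicit.
Unset Printing Implicit Defensive.

Import Order.TTheory GRing.Theory.

Local Open Scope ring_scope.
Local Open Scope quotient_scope.

Record fincat := FinCat {
  obj :> finType;
  hom : obj -> obj -> finType;
  idm : forall x, hom x x;
  comp : forall x y z, hom y z -> hom x y -> hom x z;
  comp1m : forall x y (f : hom x y), comp (idm y) f = f;
  compm1 : forall x y (f : hom x y), comp f (idm x) = f;
  compA : forall x y z t (h : hom z t) (g : hom y z) (f : hom x y),
    comp h (comp g f) = comp (comp h g) f
}.

Arguments idm {f} x : rename.
Arguments comp {f x y z} _ _ : rename.
Arguments hom {f} _ _ : rename.

Declare Scope fincat_scope.
Delimit Scope fincat_scope with CAT.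
Notation "g \oc f" := (comp g f) (at level 40, left associativity) : fincat_scope.
Local Open Scope fincat_scope.

Definition is_iso (C : fincat) (x y : C) (f : hom x y) : Prop :=
  exists g : hom y x, g \oc f = idm x /\ f \oc g = idm y.

Definition EI_category (C : fincat) : Prop :=
  forall (x : C) (f : hom x x), is_iso f.

Definition skeletal (C : fincat) : Prop :=
  forall x y : C, (exists f : hom x y, is_iso f) -> x = y.

(* An isomorphism of categories: a functor that is bijective on objects and on
   every morphism set. *)
Definition cat_isomorphic (C D : fincat) : Prop :=
  exists (Fo : C -> D) (Fm : forall x y : C, hom x y -> hom (Fo x) (Fo y)),
    [/\ forall x, Fm x x (idm x) = idm (Fo x),
        forall x y z (g : hom y z) (f : hom x y),
          Fm x z (g \oc f) = Fm y z g \oc Fm x y f,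
        bijective Fo
      & forall x y, bijective (Fm x y)].

Section PosetCat.
Variables (d : Order.disp_t) (P : finPOrderType d).

(* [unit] cut down by the truth value of [x <= y]: one element or none. *)
Definition poset_hom (x y : P) : finType := {u : unit | (x <= y)%O}.

Definition poset_idm (x : P) : poset_hom x x := exist _ tt (lexx x).

Definition poset_comp (x y z : P) (g : poset_hom y z) (f : poset_hom x y) :
  poset_hom x z := exist _ tt (le_trans (valP f) (valP g)).

Lemma poset_hom_irr (x y : P) (f g : poset_hom x y) : f = g.
Proof. by apply: val_inj; case: (val f); case: (val g). Qed.

Definition poset_cat : fincat :=
  @FinCat P poset_hom poset_idm poset_comp
    (fun _ _ _ => poset_hom_irr _ _) (fun _ _ _ => poset_hom_irr _ _)
    (fun _ _ _ _ _ _ _ => poset_hom_irr _ _).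
End PosetCat.

Section Endotrivialisation.
Variable C : fincat.

(* Related morphisms are automatically parallel, so the relation is defined on
   each morphism set. *)
Definition etriv1 (x y : C) : rel (hom x y) := fun f g =>
  [exists z : C, exists f2 : hom z y, exists f1 : hom x z,
   exists h1 : hom z z, exists h2 : hom z z,
     (f == f2 \oc h1 \oc f1) && (g == f2 \oc h2 \oc f1)].

(* [connect] is the reflexive transitive closure; [etriv1] being reflexive,
   this is its transitive hull. *)
Definition etriv (x y : C) : rel (hom x y) := connect (@etriv1 x y).

Lemma etriv1P (x y : C) (f g : hom x y) :
  reflect (exists (z : C) (f2 : hom z y) (f1 : hom x z) (h1 h2 : hom z z),
             f = f2 \oc h1 \oc f1 /\ g = f2 \oc h2 \oc f1)
          (etriv1 f g).
Proof.
apply: (iffP existsP) => [[z /existsP[f2 /existsP[f1 /existsP[h1 /existsP[h2]]]]]|].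
  by case/andP=> /eqP-> /eqP->; exists z, f2, f1, h1, h2.
case=> z [f2 [f1 [h1 [h2 [-> ->]]]]].
exists z; apply/existsP; exists f2; apply/existsP; exists f1; apply/existsP.
by exists h1; apply/existsP; exists h2; rewrite !eqxx.
Qed.

Lemma etriv1_refl (x y : C) : reflexive (@etriv1 x y).
Proof.
move=> f; apply/etriv1P; exists y, (idm y), f, (idm y), (idm y).
by rewrite !comp1m.
Qed.

Lemma etriv1_sym (x y : C) : symmetric (@etriv1 x y).
Proof.
by move=> f g; apply/etriv1P/etriv1P; move=> [z [f2 [f1 [h1 [h2 [-> ->]]]]]];
   exists z, f2, f1, h2, h1.
Qed.

Lemma etriv_refl (x y : C) : reflexive (@etriv x y).
Proof. by move=> f; apply: connect0. Qed.

Lemma etriv_sym (x y : C) : symmetric (@etriv x y).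
Proof. exact/sym_connect_sym/etriv1_sym. Qed.

Lemma etriv_trans (x y : C) : transitive (@etriv x y).
Proof. exact: connect_trans. Qed.

Lemma etriv_compl (x y z : C) (g : hom y z) (f f' : hom x y) :
  etriv f f' -> etriv (g \oc f) (g \oc f').
Proof.
case/connectP=> p; elim: p f => [|f1 p IHp] f /= => [_ ->|]; first exact: etriv_refl.
case/andP=> /etriv1P[t [u [v [h1 [h2 [-> Ef1]]]]]] /IHp{}IHp /IHp.
apply: etriv_trans; apply: connect1; apply/etriv1P.
by exists t, (g \oc u), v, h1, h2; rewrite Ef1 !compA.
Qed.

Lemma etriv_compr (x y z : C) (g g' : hom y z) (f : hom x y) :
  etriv g g' -> etriv (g \oc f) (g' \oc f).
Proof.
case/connectP=> p; elim: p g => [|g1 p IHp] g /= => [_ ->|]; first exact: etriv_refl.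
case/andP=> /etriv1P[t [u [v [h1 [h2 [-> Eg1]]]]]] /IHp{}IHp /IHp.
apply: etriv_trans; apply: connect1; apply/etriv1P.
by exists t, u, (v \oc f), h1, h2; rewrite Eg1 !compA.
Qed.

Canonical etriv_equiv (x y : C) :=
  EquivRel (@etriv x y) (@etriv_refl x y) (@etriv_sym x y) (@etriv_trans x y).

(* [quot_type Q] is [Q], viewed as a finite type. *)
Definition et_hom (x y : C) : finType := quot_type {eq_quot (@etriv x y)}.

Definition et_pi (x y : C) (f : hom x y) : et_hom x y :=
  \pi_({eq_quot (@etriv x y)}) f.

Lemma et_piP (x y : C) (f g : hom x y) : et_pi f = et_pi g <-> etriv f g.
Proof. by split=> [/eqmodP|fg]; last apply/eqmodP. Qed.

Definition et_repr (x y : C) (u : et_hom x y) : hom x y :=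
  repr (u : {eq_quot (@etriv x y)}).

Lemma et_reprK (x y : C) (u : et_hom x y) : et_pi (et_repr u) = u.
Proof. exact: reprK. Qed.

Definition et_idm (x : C) : et_hom x x := et_pi (idm x).

Definition et_comp (x y z : C) (v : et_hom y z) (u : et_hom x y) : et_hom x z :=
  et_pi (et_repr v \oc et_repr u).

Lemma et_piM (x y z : C) (g : hom y z) (f : hom x y) :
  et_comp (et_pi g) (et_pi f) = et_pi (g \oc f).
Proof.
apply/et_piP; apply: (@etriv_trans _ _ (g \oc et_repr (et_pi f))).
  by apply: etriv_compr; apply/et_piP; rewrite et_reprK.
by apply: etriv_compl; apply/et_piP; rewrite et_reprK.
Qed.

Lemma et_comp1m (x y : C) (u : et_hom x y) : et_comp (et_idm y) u = u.
Proof. by rewrite -[u]et_reprK et_piM comp1m. Qed.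

Lemma et_compm1 (x y : C) (u : et_hom x y) : et_comp u (et_idm x) = u.
Proof. by rewrite -[u]et_reprK et_piM compm1. Qed.

Lemma et_compA (x y z t : C) (w : et_hom z t) (v : et_hom y z) (u : et_hom x y) :
  et_comp w (et_comp v u) = et_comp (et_comp w v) u.
Proof. by rewrite -[u]et_reprK -[v]et_reprK -[w]et_reprK !et_piM compA. Qed.

Definition endotriv : fincat := FinCat et_comp1m et_compm1 et_compA.
End Endotrivialisation.

(* MathComp's [algType] excludes the zero ring, which is the category algebra
   of the empty category; hence algebras over [k] are taken as possibly zero
   rings with a central structure map from [k]. *)
Record algebra (k : fieldType) := Algebra {
  alg_ring :> pzRingType;
  alg_scal : {rmorphism k -> alg_ring};
  alg_scalC : forall (c : k) (a : alg_ring), alg_scal c * a = a * alg_scal c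
}.

Section RepresentationType.
Variables (k : fieldType) (A : algebra k).

Definition findim_module (V : lmodType A) : Prop :=
  exists s : seq V, forall v : V, exists c : 'I_(size s) -> k,
    v = \sum_(i < size s) alg_scal A (c i) *: s`_i.

Definition module_isomorphic (V W : lmodType A) : Prop :=
  exists f : {linear V -> W}, bijective f.

Definition zero_module (V : lmodType A) : Prop := forall v : V, v = 0.

Definition indecomposable (V : lmodType A) : Prop :=
  ~ zero_module V /\
  forall U W : lmodType A,
    module_isomorphic V (U * W)%type -> zero_module U \/ zero_module W.

Definition algebra_finite_rep_type : Prop :=
  exists (n : nat) (M : 'I_n -> lmodType A),
    forall V : lmodType A, findim_module V -> indecomposable V ->
      exists i, module_isomorphic V (M i).
End RepresentationType.

Section CategoryAlgebra.
Variables (k : fieldType) (C : fincat).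

Definition arrow : finType := {p : C * C & hom p.1 p.2}.
Definition Arrow (x y : C) (f : hom x y) : arrow :=
  existT (fun p : C * C => hom p.1 p.2) (x, y) f.

Definition cat_alg := {ffun arrow -> k^o}.
HB.instance Definition _ := GRing.Lmodule.copy cat_alg {ffun arrow -> k^o}.

Definition basis_elt (a : arrow) : cat_alg := [ffun b => (b == a)%:R].

Definition cat_alg_one : cat_alg :=
  [ffun a => (a == Arrow (idm (tag a).1))%:R].

(* The coefficient of the product at [h : x -> z] collects all factorisations
   [h = g \oc f]; see [basis_elt_mul] and [basis_elt_mul0]. *)
Definition cat_alg_mul (u v : cat_alg) : cat_alg :=
  [ffun a : arrow => \sum_(y : C) \sum_(g : hom y (tag a).2)
     \sum_(f : hom (tag a).1 y | g \oc f == tagged a)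
       u (Arrow g) * v (Arrow f)].

Lemma arrow_eqE (x y : C) (f g : hom x y) : (Arrow f == Arrow g) = (f == g).
Proof. by rewrite eq_Tagged. Qed.

Lemma cat_alg_mulE (u v : cat_alg) (x z : C) (h : hom x z) :
  cat_alg_mul u v (Arrow h) =
  \sum_(y : C) \sum_(g : hom y z) \sum_(f : hom x y | g \oc f == h)
    u (Arrow g) * v (Arrow f).
Proof. by rewrite ffunE. Qed.

Lemma cat_alg_extP (u v : cat_alg) :
  (forall (x y : C) (f : hom x y), u (Arrow f) = v (Arrow f)) -> u = v.
Proof. by move=> uv; apply/ffunP => -[[x y] f]; apply: uv. Qed.

Lemma cat_alg_mulA : associative cat_alg_mul.
Proof.
move=> u v w; apply: cat_alg_extP => x t h; rewrite !cat_alg_mulE.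
transitivity (\sum_(z : C) \sum_(y : C) \sum_(e : hom z t) \sum_(g : hom y z)
    \sum_(f : hom x y | e \oc g \oc f == h)
    u (Arrow e) * v (Arrow g) * w (Arrow f)).
  apply: eq_bigr => z _; rewrite exchange_big /=; apply: eq_bigr => e _.
  transitivity (\sum_(p : hom x z | e \oc p == h) \sum_(y : C)
      \sum_(g : hom y z) \sum_(f : hom x y | g \oc f == p)
      u (Arrow e) * v (Arrow g) * w (Arrow f)).
    apply: eq_bigr => p _; rewrite cat_alg_mulE mulr_sumr; apply: eq_bigr => y _.
    rewrite mulr_sumr; apply: eq_bigr => g _; rewrite mulr_sumr.
    by apply: eq_bigr => f _; rewrite mulrA.
  rewrite exchange_big /=; apply: eq_bigr => y _.
  rewrite exchange_big /=; apply: eq_bigr => g _.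
  rewrite (exchange_big_dep xpredT) //= [RHS]big_mkcond /=; apply: eq_bigr => f _.
  rewrite -compA; case: ifP => E.
    rewrite (big_pred1 (g \oc f)) // => p /=.
    by rewrite [_ == p]eq_sym andbC; case: eqP => // ->; rewrite E.
  rewrite big_pred0 // => p /=.
  by rewrite [_ == p]eq_sym andbC; case: eqP => // ->; rewrite E.
rewrite exchange_big /=; apply: eq_bigr => y _.
transitivity (\sum_(q : hom y t) \sum_(f : hom x y | q \oc f == h) \sum_(z : C)
    \sum_(e : hom z t) \sum_(g : hom y z | e \oc g == q)
    u (Arrow e) * v (Arrow g) * w (Arrow f)); last first.
  apply: eq_bigr => q _; apply: eq_bigr => f _.
  rewrite cat_alg_mulE mulr_suml; apply: eq_bigr => z _.
  by rewrite mulr_suml; apply: eq_bigr => e _; rewrite mulr_suml.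
under [RHS]eq_bigr => q _ do rewrite exchange_big.
rewrite [RHS]exchange_big /=; apply: eq_bigr => z _.
under [RHS]eq_bigr => q _ do rewrite exchange_big.
rewrite [RHS]exchange_big /=; apply: eq_bigr => e _.
under [RHS]eq_bigr => q _ do rewrite (exchange_big_dep xpredT) //=.
rewrite [RHS]exchange_big /=; apply: eq_bigr => g _.
rewrite (exchange_big_dep xpredT) //= [LHS]big_mkcond /=; apply: eq_bigr => f _.
case: ifP => E.
  rewrite (big_pred1 (e \oc g)) // => p /=.
  by rewrite [_ == p]eq_sym andbC; case: eqP => // ->; rewrite E.
rewrite big_pred0 // => p /=.
by rewrite [_ == p]eq_sym andbC; case: eqP => // ->; rewrite E.
Qed.

Lemma cat_alg_oneE (x : C) (f : hom x x) :
  cat_alg_one (Arrow f) = (f == idm x)%:R.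
Proof. by rewrite ffunE /= arrow_eqE. Qed.

Lemma cat_alg_one_neq (x y : C) (f : hom x y) :
  x != y -> cat_alg_one (Arrow f) = 0.
Proof.
move=> neq_xy; rewrite ffunE /=; case: eqP => // /(congr1 tag)/= [yx].
by rewrite yx eqxx in neq_xy.
Qed.

Lemma cat_alg_mul1 : left_id cat_alg_one cat_alg_mul.
Proof.
move=> v; apply: cat_alg_extP => x z h; rewrite cat_alg_mulE.
rewrite (bigD1 z) //= [X in _ + X]big1 ?addr0; last first.
  move=> y neq_yz; apply: big1 => g _; apply: big1 => f _.
  by rewrite cat_alg_one_neq ?mul0r.
rewrite (bigD1 (idm z)) //= [X in _ + X]big1 ?addr0; last first.
  move=> g /negPf neq_g; apply: big1 => f _.
  by rewrite cat_alg_oneE neq_g mul0r.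
rewrite (big_pred1 h) => [|f]; first by rewrite cat_alg_oneE eqxx mul1r.
by rewrite /= comp1m.
Qed.

Lemma cat_alg_mulr1 : right_id cat_alg_one cat_alg_mul.
Proof.
move=> v; apply: cat_alg_extP => x z h; rewrite cat_alg_mulE.
rewrite (bigD1 x) //= [X in _ + X]big1 ?addr0; last first.
  move=> y neq_yx; apply: big1 => g _; apply: big1 => f _.
  by rewrite cat_alg_one_neq 1?eq_sym ?mulr0.
rewrite (bigD1 h) //= [X in _ + X]big1 ?addr0; last first.
  move=> g /negPf neq_g; apply: big1 => f /eqP Eh.
  rewrite cat_alg_oneE; case: eqP => [Ef|_]; last by rewrite mulr0.
  by rewrite -Eh Ef compm1 eqxx in neq_g.
rewrite (bigD1 (idm x)) /= ?compm1 // cat_alg_oneE eqxx mulr1.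
rewrite big1 ?addr0 // => f /andP[_ /negPf neq_f].
by rewrite cat_alg_oneE neq_f mulr0.
Qed.

Lemma cat_alg_mulDl : left_distributive cat_alg_mul +%R.
Proof.
move=> u v w; apply: cat_alg_extP => x z h.
rewrite [RHS]ffunE !cat_alg_mulE -big_split; apply: eq_bigr => y _ /=.
rewrite -big_split; apply: eq_bigr => g _ /=; rewrite -big_split.
by apply: eq_bigr => f _ /=; rewrite ffunE mulrDl.
Qed.

Lemma cat_alg_mulDr : right_distributive cat_alg_mul +%R.
Proof.
move=> u v w; apply: cat_alg_extP => x z h.
rewrite [RHS]ffunE !cat_alg_mulE -big_split; apply: eq_bigr => y _ /=.
rewrite -big_split; apply: eq_bigr => g _ /=; rewrite -big_split.
by apply: eq_bigr => f _ /=; rewrite ffunE mulrDr.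
Qed.

HB.instance Definition _ := GRing.Zmodule_isPzRing.Build cat_alg
  cat_alg_mulA cat_alg_mul1 cat_alg_mulr1 cat_alg_mulDl cat_alg_mulDr.

Lemma cat_alg_scalerAl (c : k) (u v : cat_alg) : c *: (u * v) = (c *: u) * v.
Proof.
apply: cat_alg_extP => x z h; rewrite ffunE !cat_alg_mulE.
rewrite scaler_sumr; apply: eq_bigr => y _.
rewrite scaler_sumr; apply: eq_bigr => g _.
by rewrite scaler_sumr; apply: eq_bigr => f _; rewrite ffunE scalerAl.
Qed.

Lemma cat_alg_scalerAr (c : k) (u v : cat_alg) : c *: (u * v) = u * (c *: v).
Proof.
apply: cat_alg_extP => x z h; rewrite ffunE !cat_alg_mulE.
rewrite scaler_sumr; apply: eq_bigr => y _.
rewrite scaler_sumr; apply: eq_bigr => g _.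
by rewrite scaler_sumr; apply: eq_bigr => f _; rewrite ffunE scalerAr.
Qed.

Definition cat_alg_scal (c : k) : cat_alg := c *: cat_alg_one.

Lemma cat_alg_scal_is_additive : zmod_morphism cat_alg_scal.
Proof. by move=> c d; rewrite /cat_alg_scal scalerBl. Qed.

Lemma cat_alg_scal_is_multiplicative : monoid_morphism cat_alg_scal.
Proof.
split; first by rewrite /cat_alg_scal scale1r.
by move=> c d; rewrite /cat_alg_scal -cat_alg_scalerAl mul1r scalerA.
Qed.

HB.instance Definition _ := GRing.isZmodMorphism.Build k cat_alg cat_alg_scal
  cat_alg_scal_is_additive.
HB.instance Definition _ := GRing.isMonoidMorphism.Build k cat_alg cat_alg_scal
  cat_alg_scal_is_multiplicative.

Lemma cat_alg_scalC (c : k) (u : cat_alg) : cat_alg_scal c * u = u * cat_alg_scal c.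
Proof.
by rewrite /cat_alg_scal -cat_alg_scalerAl -cat_alg_scalerAr mul1r mulr1.
Qed.

Definition category_algebra : algebra k :=
  @Algebra k cat_alg cat_alg_scal cat_alg_scalC.

Lemma basis_elt_mul (x y z : C) (g : hom y z) (f : hom x y) :
  basis_elt (Arrow g) * basis_elt (Arrow f) = basis_elt (Arrow (g \oc f)).
Proof.
have neqA (a b : arrow) : tag a != tag b -> (a == b) = false.
  by move=> ab; apply: contraNF ab => /eqP->.
apply: cat_alg_extP => x' z' h; rewrite cat_alg_mulE [RHS]ffunE.
have [Ex|nx] := eqVneq x' x; last first.
  rewrite neqA /= ?xpair_eqE ?negb_and ?nx //.
  apply: big1 => y' _; apply: big1 => g' _; apply: big1 => f' _.
  by rewrite [X in _ * X]ffunE neqA ?mulr0 //= xpair_eqE negb_and nx.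
have [Ez|nz] := eqVneq z' z; last first.
  rewrite neqA /= ?xpair_eqE ?negb_and ?nz ?orbT //.
  apply: big1 => y' _; apply: big1 => g' _; apply: big1 => f' _.
  by rewrite ffunE neqA ?mul0r //= xpair_eqE negb_and nz orbT.
subst x' z'; rewrite (bigD1 y) //= [X in _ + X]big1 ?addr0; last first.
  move=> y' ny; apply: big1 => g' _; apply: big1 => f' _.
  by rewrite ffunE neqA ?mul0r //= xpair_eqE negb_and ny.
rewrite (bigD1 g) //= [X in _ + X]big1 ?addr0; last first.
  move=> g' /negPf ng; apply: big1 => f' _.
  by rewrite ffunE arrow_eqE ng mul0r.
rewrite arrow_eqE eq_sym big_mkcond (bigD1 f) //= big1 ?addr0; last first.
  by move=> f' /negPf nf; rewrite !ffunE !arrow_eqE nf mulr0; case: ifP.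
by rewrite !ffunE !arrow_eqE !eqxx mulr1; case: ifP.
Qed.

Lemma basis_elt_mul0 (x y y' z : C) (g : hom y' z) (f : hom x y) :
  y != y' -> basis_elt (Arrow g) * basis_elt (Arrow f) = 0.
Proof.
move=> ny; apply: cat_alg_extP => x1 z1 h; rewrite cat_alg_mulE [RHS]ffunE.
apply: big1 => y1 _; apply: big1 => g1 _; apply: big1 => f1 _; rewrite !ffunE.
case: eqP => [/(congr1 tag)/= [Ey _]|_]; last by rewrite mul0r.
case: eqP => [/(congr1 tag)/= [_ Ey']|_]; last by rewrite mulr0.
by rewrite -Ey -Ey' eqxx in ny.
Qed.
End CategoryAlgebra.

Definition finite_rep_type (k : fieldType) (C : fincat) : Prop :=
  algebra_finite_rep_type (category_algebra k C).

(* Main.v *)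
From HB Require Import structures.
From mathcomp Require Import all_boot all_order all_algebra.
From Stdlib Require Import Classical.
Require Import Defs.

(** In a skeletal EI-category two objects with morphisms in both directions are
equal ([EI_skeletal_directed]), so that [x <= y] iff [hom x y] is nonempty is a
partial order on the objects. The endotrivialisation is the category of this
poset as soon as any two parallel morphisms are equivalent, and this is where
finite representation type enters ([finite_rep_type_etriv]).

Suppose that some [hom x y] contains inequivalent morphisms [f0] and [f1]. The
endotrivialisation then contains a Kronecker quiver, whose indecomposable
representations [1, J : k^n -> k^n], with [J] a nilpotent Jordan block, exist in
every dimension over every field. They extend to modules over the category
algebra without any Kan extension when [y] is chosen minimal, so that for [z]
strictly between [x] and [y] all morphisms [x -> z] are equivalent. Put [k^n] at
every object between [x] and [y] and [0] elsewhere; let a morphism [f : z -> y]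
with [z != y] act as [1] or [J] according to whether [f \oc g], for [g : x -> z],
is equivalent to [f0] or not, and all others act as [1]. Minimality says that
the choice of [g] is irrelevant, whence functoriality ([twisted_comp]). An
endomorphism is the same matrix [E] at every object, commuting with [J]; if it
is idempotent then [E] is [0] or [1] ([jordan0_commute_idem]), so the module is
indecomposable ([kronecker_indecomposable]). Modules with different [n] are not
isomorphic, so there are infinitely many classes ([kronecker_infinite]).

The functor from the category to the poset is full and bijective on objects, so
it induces a surjection of category algebras ([finite_rep_type_full]), and
finite representation type passes to quotient algebras by restriction of
scalars ([finite_rep_type_surj]). *)

Set Implicit Arguments.
Unset Strict Implicit.
Unset Printing Implicit Defensive.

Import Order.TTheory GRing.Theory.

Local Open Scope ring_scope.
Local Open Scope fincat_scope.

(** * Modules over an algebra *)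

Lemma linear_module_isomorphic (k : fieldType) (A : algebra k)
    (V W : lmodType A) (f : V -> W) :
  linear f -> bijective f -> module_isomorphic V W.
Proof.
move=> f_lin f_bij.
pose F := GRing.isLinear.Build _ _ _ _ f f_lin.
by exists (HB.pack_for {linear V -> W} f F).
Qed.

Lemma module_isomorphic_sym (k : fieldType) (A : algebra k) (V W : lmodType A) :
  module_isomorphic V W -> module_isomorphic W V.
Proof.
case=> f [g fK gK].
exact: (linear_module_isomorphic (can2_linear fK gK) (Bijective gK fK)).
Qed.

Lemma module_isomorphic_trans (k : fieldType) (A : algebra k)
    (V W X : lmodType A) :
  module_isomorphic V W -> module_isomorphic W X -> module_isomorphic V X.
Proof.
case=> f f_bij [g g_bij]; apply: (@linear_module_isomorphic _ _ _ _ (g \o f)).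
  exact: linearP.
exact: bij_comp.
Qed.

Lemma findim_module_family (k : fieldType) (A : algebra k) (V : lmodType A)
    (T : finType) (b : T -> V) (c : V -> T -> k) :
  (forall v, v = \sum_t alg_scal A (c v t) *: b t) -> findim_module V.
Proof.
move=> b_span; exists (codom b) => v.
exists (fun i => c v (enum_val (cast_ord (size_codom b) i))).
rewrite {1}[v]b_span (reindex _ (onW_bij _ (enum_val_bij T))) /=.
rewrite (reindex _ (onW_bij _ (Bijective (cast_ordK (size_codom b))
                                         (cast_ordKV (size_codom b))))) /=.
by apply: eq_bigr => i _; rewrite -(nth_codom 0 b).
Qed.

Lemma indecomposable_idem (k : fieldType) (A : algebra k) (V : lmodType A) :
  ~ zero_module V ->
  (forall e : {linear V -> V}, e \o e =1 e -> e =1 \0 \/ e =1 id) ->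
  indecomposable V.
Proof.
move=> V_n0 V_idem; split=> // U W [f [g fK gK]].
have g_lin := can2_linear fK gK.
pose gL : {linear (U * W)%type -> V} :=
  HB.pack_for {linear (U * W)%type -> V} g
    (GRing.isLinear.Build _ _ _ _ g g_lin).
have e_lin : linear (fun v => gL ((f v).1, 0)).
  move=> a u v; rewrite -(linearP gL) (linearP f); congr (gL _).
  by congr (_, _); rewrite /= scaler0 addr0.
(* the projection onto U along W *)
pose e : {linear V -> V} := HB.pack_for {linear V -> V}
  (fun v => gL ((f v).1, 0)) (GRing.isLinear.Build _ _ _ _ _ e_lin).
have [|e0|e1] := V_idem e; first by move=> v /=; rewrite gK.
  left=> u; have /= := e0 (g (u, 0)).
  by rewrite gK => /(congr1 f); rewrite gK linear0 => -[].
right=> w; have /= := e1 (g (0, w)).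
by rewrite gK => /(congr1 f); rewrite !gK => -[].
Qed.

(** * Finite representation type passes to quotient algebras *)

Definition restr_scalars (A B : pzRingType) (phi : {rmorphism A -> B})
  (V : lmodType B) : Type := V.

Section RestrictScalars.
Variables (A B : pzRingType) (phi : {rmorphism A -> B}) (V : lmodType B).

Local Notation RV := (restr_scalars phi V).
HB.instance Definition _ := GRing.Zmodule.on RV.

Definition restr_scale (a : A) (v : RV) : RV :=
  phi a *: (v : V).

Fact restr_scaleA a b v : restr_scale a (restr_scale b v) = restr_scale (a * b) v.
Proof. by rewrite /restr_scale scalerA rmorphM. Qed.
Fact restr_scale1 : left_id 1 restr_scale.
Proof. by move=> v; rewrite /restr_scale rmorph1 scale1r. Qed.
Fact restr_scaleDr : right_distributive restr_scale +%R.
Proof. by move=> a u v; apply: scalerDr. Qed.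
Fact restr_scaleDl v : {morph restr_scale^~ v : a b / a + b}.
Proof. by move=> a b; rewrite /restr_scale rmorphD scalerDl. Qed.

HB.instance Definition _ := GRing.Zmodule_isLmodule.Build A RV
  restr_scaleA restr_scale1 restr_scaleDr restr_scaleDl.

Lemma restr_scaleE a v : a *: (v : RV) = phi a *: (v : V).
Proof. by []. Qed.
End RestrictScalars.

(** A module killed by the kernel of a surjection [phi : A -> B] is a [B]-module;
[b] acts through any preimage, so a section [s] with no algebraic properties is
enough. The two hypotheses are arguments of the carrier so that the structure
can be attached to it. *)
Section ExtendScalars.
Variables (A B : pzRingType) (phi : {rmorphism A -> B}) (s : B -> A).
Hypothesis sK : cancel s phi.
Variable U : lmodType A.
Hypothesis ker0 : forall a (u : U), phi a = 0 -> a *: u = 0.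

Definition quot_scalars & cancel s phi
  & (forall a (u : U), phi a = 0 -> a *: u = 0) : Type := U.
Local Notation QU := (quot_scalars sK ker0).
HB.instance Definition _ := GRing.Zmodule.on QU.

Lemma ker_scale a b (u : U) : phi a = phi b -> a *: u = b *: u.
Proof.
by move=> ab; apply/eqP; rewrite -subr_eq0 -scalerBl ker0 // rmorphB ab subrr.
Qed.

Definition quot_scale (b : B) (u : QU) : QU := s b *: (u : U).

Fact quot_scaleA a b v : quot_scale a (quot_scale b v) = quot_scale (a * b) v.
Proof. by rewrite /quot_scale scalerA; apply: ker_scale; rewrite rmorphM !sK. Qed.
Fact quot_scale1 : left_id 1 quot_scale.
Proof.
by move=> v; rewrite -[RHS](scale1r (v : U)); apply: ker_scale; rewrite sK rmorph1.
Qed.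
Fact quot_scaleDr : right_distributive quot_scale +%R.
Proof. by move=> a u v; apply: scalerDr. Qed.
Fact quot_scaleDl v : {morph quot_scale^~ v : a b / a + b}.
Proof.
move=> a b; rewrite /quot_scale -scalerDl; apply: ker_scale.
by rewrite rmorphD !sK.
Qed.

HB.instance Definition _ := GRing.Zmodule_isLmodule.Build B QU
  quot_scaleA quot_scale1 quot_scaleDr quot_scaleDl.

Lemma quot_scaleE a (u : QU) : phi a *: u = a *: (u : U).
Proof. by apply: ker_scale; rewrite sK. Qed.
End ExtendScalars.

Section SurjectionTransfer.
Variables (k : fieldType) (A B : algebra k) (phi : {rmorphism A -> B}) (s : B -> A).
Hypothesis phi_scal : forall c, phi (alg_scal A c) = alg_scal B c.
Hypothesis sK : cancel s phi.
Local Notation infl V := (restr_scalars phi V : lmodType A).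

Lemma infl_isomorphic (V W : lmodType B) :
  module_isomorphic (infl V) (infl W) -> module_isomorphic V W.
Proof.
case=> f f_bij; apply: (@linear_module_isomorphic _ _ _ _ (f : V -> W)) f_bij.
move=> b u v; rewrite -[b]sK -(@restr_scaleE _ _ phi).
exact: (linearP f (s b) (u : infl V) v).
Qed.

Lemma infl_findim (V : lmodType B) : findim_module V -> findim_module (infl V).
Proof.
case=> r r_span; exists r => v; case: (r_span v) => c Ev; exists c.
by rewrite {1}Ev; apply: eq_bigr => i _; rewrite restr_scaleE phi_scal.
Qed.

(** The kernel of [phi] kills the inflated module, hence both summands of any
decomposition, which is therefore one over [B]. *)
Lemma infl_indecomposable (V : lmodType B) :
  indecomposable V -> indecomposable (infl V).
Proof.
case=> V_n0 V_ind; split=> // U W [f [g fK gK]].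
have kerUW a (p : U * W) : phi a = 0 -> a *: p = 0.
  move=> a0; rewrite -[p]gK -linearZ restr_scaleE a0 scale0r.
  exact: (linear0 f).
have kerU a (u : U) : phi a = 0 -> a *: u = 0.
  by move=> /(kerUW _ (u, 0)) [].
have kerW a (w : W) : phi a = 0 -> a *: w = 0.
  by move=> /(kerUW _ (0, w)) [].
pose QU : lmodType B := quot_scalars sK kerU.
pose QW : lmodType B := quot_scalars sK kerW.
apply: (V_ind QU QW).
apply: (@linear_module_isomorphic _ B V (QU * QW)%type (f : V -> U * W)%type).
  move=> b u v; rewrite -[b]sK -(@restr_scaleE _ _ phi).
  rewrite (linearP f (s b) (u : infl V) v).
  by congr (_, _); rewrite /= quot_scaleE.
by exists g.
Qed.

(** From a list of representatives for [A], keep those that are inflated from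
[B]; the other entries can be replaced by anything, here the regular module. *)
Lemma finite_rep_type_surj :
  algebra_finite_rep_type A -> algebra_finite_rep_type B.
Proof.
case=> n [M M_all].
have [N MN] : exists N : 'I_n -> lmodType B, forall i,
    (exists V : lmodType B, module_isomorphic (infl V) (M i)) ->
    module_isomorphic (infl (N i)) (M i).
  apply: (@fin_all_exists _ (fun=> lmodType B) (fun i N =>
    (exists V : lmodType B, module_isomorphic (infl V) (M i)) ->
    module_isomorphic (infl N) (M i))) => i.
  case: (classic (exists V : lmodType B, module_isomorphic (infl V) (M i))).
    by case=> V VM; exists V.
  by move=> noV; exists (B^o : lmodType B).
exists n, N => V V_fin V_ind.
have [i VM] := M_all _ (infl_findim V_fin) (infl_indecomposable V_ind).
exists i; apply: infl_isomorphic; apply: (module_isomorphic_trans VM).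
by apply: module_isomorphic_sym; apply: MN; exists V.
Qed.
End SurjectionTransfer.

(** * Full functors and category algebras *)

Section CategoryAlgebraBasis.
Variables (k : fieldType) (C : fincat).
Implicit Types u v : cat_alg k C.

Lemma cat_alg_basis u : u = \sum_a u a *: basis_elt k a.
Proof.
apply/ffunP => b; rewrite sum_ffunE (bigD1 b) //= big1 ?addr0 => [|a /negPf ab].
  by rewrite !ffunE eqxx /= [RHS]mulr1.
by rewrite !ffunE eq_sym ab /= [LHS]mulr0.
Qed.

Lemma cat_alg_one_basis : 1 = \sum_(x : C) basis_elt k (Arrow (idm x)).
Proof.
apply: cat_alg_extP => x y f; rewrite sum_ffunE.
have [Exy|nxy] := eqVneq x y; last first.
  rewrite cat_alg_one_neq // big1 // => z _; rewrite ffunE.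
  by case: eqP => // /(congr1 tag)/= [xz yz]; rewrite xz yz eqxx in nxy.
subst y; rewrite cat_alg_oneE (bigD1 x) //= big1 ?addr0 => [|z /negPf xz].
  by rewrite ffunE arrow_eqE.
by rewrite ffunE; case: eqP => // /(congr1 tag)/= [zx _]; rewrite zx eqxx in xz.
Qed.
End CategoryAlgebraBasis.

Section FunctorAlgebra.
Variables (k : fieldType) (C D : fincat).
Variables (Fo : C -> D) (Fm : forall x y : C, hom x y -> hom (Fo x) (Fo y)).
Arguments Fm {x y}.
Hypothesis F1 : forall x, Fm (idm x) = idm (Fo x).
Hypothesis FM : forall x y z (g : hom y z) (f : hom x y),
  Fm (g \oc f) = Fm g \oc Fm f.
Hypothesis Fo_bij : bijective Fo.

Definition functor_arrow (a : arrow C) : arrow D := Arrow (Fm (tagged a)).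

Definition functor_alg (u : cat_alg k C) : cat_alg k D :=
  \sum_a u a *: basis_elt k (functor_arrow a).

Fact functor_alg_linear : linear functor_alg.
Proof.
move=> c u v; rewrite /functor_alg scaler_sumr -big_split; apply: eq_bigr => a _.
by rewrite !ffunE scalerDl scalerA.
Qed.
HB.instance Definition _ := GRing.isLinear.Build k (cat_alg k C) (cat_alg k D)
  *:%R functor_alg functor_alg_linear.

Lemma functor_alg_basis a :
  functor_alg (basis_elt k a) = basis_elt k (functor_arrow a).
Proof.
rewrite /functor_alg (bigD1 a) //= big1 ?addr0 => [|b /negPf ab].
  by rewrite ffunE eqxx scale1r.
by rewrite ffunE ab scale0r.
Qed.

(** Injectivity of [Fo] keeps non-composable arrows non-composable, so that zero
products are preserved; surjectivity is needed for the unit. *)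
Fact functor_alg_monoid : monoid_morphism functor_alg.
Proof.
split=> [|u v].
  rewrite !cat_alg_one_basis linear_sum [RHS](reindex _ (onW_bij _ Fo_bij)) /=.
  by apply: eq_bigr => x _; rewrite functor_alg_basis /functor_arrow /= F1.
have FbM a b : functor_alg (basis_elt k a * basis_elt k b) =
    basis_elt k (functor_arrow a) * basis_elt k (functor_arrow b).
  case: a b => [[y' z] /= g] [[x y] /= f]; rewrite /functor_arrow /=.
  have [Ey|ny] := eqVneq y y'.
    by subst y'; rewrite !basis_elt_mul functor_alg_basis /functor_arrow /= FM.
  by rewrite !basis_elt_mul0 ?linear0 ?(inj_eq (bij_inj Fo_bij)).
rewrite {1}[u]cat_alg_basis {1}[v]cat_alg_basis mulr_suml linear_sum.
rewrite [in RHS]/functor_alg mulr_suml; apply: eq_bigr => a _.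
rewrite !mulr_sumr linear_sum; apply: eq_bigr => b _.
rewrite -!cat_alg_scalerAl -!cat_alg_scalerAr !linearZ /=.
by rewrite FbM !scalerA mulrC.
Qed.
HB.instance Definition _ := GRing.isMonoidMorphism.Build
  (cat_alg k C) (cat_alg k D) functor_alg functor_alg_monoid.

Hypothesis Fm_full : forall x y (g : hom (Fo x) (Fo y)), exists f, g = Fm f.

Lemma finite_rep_type_full : finite_rep_type k C -> finite_rep_type k D.
Proof.
have [s sK] : exists s : arrow D -> arrow C, forall b, functor_arrow (s b) = b.
  apply: (@fin_all_exists _ (fun=> arrow C)
    (fun b a => functor_arrow a = b)) => -[[x y] g].
  have [Go GoK FoK] := Fo_bij.
  move: g; rewrite -(FoK x) -(FoK y) /= => g; have [f ->] := Fm_full g.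
  by exists (Arrow f).
pose sec (v : cat_alg k D) : cat_alg k C := \sum_b v b *: basis_elt k (s b).
apply: (@finite_rep_type_surj k (category_algebra k C) (category_algebra k D)
          functor_alg sec) => [c|v].
  change (functor_alg (c *: cat_alg_one k C) = c *: cat_alg_one k D).
  by rewrite linearZ; congr (_ *: _); apply: rmorph1.
change (functor_alg (\sum_b v b *: basis_elt k (s b)) = v).
rewrite linear_sum [RHS]cat_alg_basis; apply: eq_bigr => b _.
by rewrite linearZ /= functor_alg_basis sK.
Qed.
End FunctorAlgebra.

(** * Idempotents commuting with a nilpotent Jordan block *)

Section NilpotentJordanBlock.
Variables (k : fieldType) (n : nat).

Definition jordan0 : 'M[k]_n.+1 := \matrix_(i, j) (i == j.+1 :> nat)%:R.

Lemma mul_jordan0 (E : 'M[k]_n.+1) (i j j' : 'I_n.+1) :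
  j' = j.+1 :> nat -> (E *m jordan0) i j = E i j'.
Proof.
move=> jj'; rewrite mxE (bigD1 j') //= mxE jj' eqxx mulr1 big1 ?addr0 //.
move=> l /eqP lj'; rewrite mxE; case: eqP => [lj|_]; last exact: mulr0.
by case: lj'; apply: val_inj; rewrite /= lj jj'.
Qed.

Lemma jordan0_mul0 (E : 'M[k]_n.+1) j : (jordan0 *m E) 0 j = 0.
Proof. by rewrite mxE big1 // => l _; rewrite mxE mul0r. Qed.

Lemma jordan0_mulS (E : 'M[k]_n.+1) (i i' j : 'I_n.+1) :
  i = i'.+1 :> nat -> (jordan0 *m E) i j = E i' j.
Proof.
move=> ii'; rewrite mxE (bigD1 i') //= mxE ii' eqxx mul1r big1 ?addr0 //.
move=> l /eqP li'; rewrite mxE; case: eqP => [il|_]; last exact: mul0r.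
by case: li'; apply: val_inj; move: il; rewrite ii' => -[].
Qed.

(** [E] equals all its powers, which vanish on more and more diagonals. *)
Lemma strict_lower_idem_eq0 (E : 'M[k]_n.+1) :
  (forall i j : 'I_n.+1, (i <= j)%N -> E i j = 0) -> E *m E = E -> E = 0.
Proof.
move=> E_low EE.
suff E0 m : forall i j : 'I_n.+1, (i <= j + m)%N -> E i j = 0.
  apply/matrixP => i j; rewrite mxE (E0 n) //.
  by rewrite (leq_trans (leq_ord i)) ?leq_addl.
elim: m => [|m IHm] i j ij; first by rewrite E_low // -[j : nat]addn0.
rewrite -EE mxE big1 // => l _; have [lj|jl] := leqP l j.
  by rewrite [E l j]E_low ?mulr0.
by rewrite [E i l]IHm ?mul0r // (leq_trans ij) // addnS -addSn leq_add2r.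
Qed.

(** The commutant of the block is the local ring [k[J]]: a matrix commuting with
[J] is lower triangular and constant along diagonals. If its diagonal entry,
itself idempotent, is [0], the matrix is strictly lower triangular; if it is
[1], this applies to the complementary idempotent. *)
Lemma jordan0_commute_idem (E : 'M[k]_n.+1) :
  E *m jordan0 = jordan0 *m E -> E *m E = E -> E = 0 \/ E = 1%:M.
Proof.
have shift (G : 'M[k]_n.+1) (i j : 'I_n.+1) :
    G *m jordan0 = jordan0 *m G -> G 0 0 = 0 -> (i <= j)%N -> G i j = 0.
  move=> GJ G00; case: i j => i lti [j ltj] /=.
  elim: j i lti ltj => [|j IHj] i lti ltj.
    rewrite leqn0 => /eqP i0; rewrite -[RHS]G00.
    by congr (G _ _); apply: val_inj; rewrite /= ?i0.
  have ltj' := ltnW ltj => ij.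
  rewrite -(@mul_jordan0 G _ (Ordinal ltj')) // GJ.
  case: i lti ij => [|i] lti ij.
    by rewrite -(jordan0_mul0 G (Ordinal ltj')); congr (_ _ _); apply: val_inj.
  by rewrite (@jordan0_mulS _ _ (Ordinal (ltnW lti))) // IHj.
move=> EJ EE.
have E0S (j : 'I_n.+1) : j != 0 -> E 0 j = 0.
  case: j => [[|j] ltj] // _.
  rewrite -(@mul_jordan0 E _ (Ordinal (ltnW ltj))) // EJ.
  exact: jordan0_mul0.
have E00 : E 0 0 * (1 - E 0 0) = 0.
  apply/eqP; rewrite mulrBr mulr1 subr_eq0 -{1}EE mxE (bigD1 0) //= big1 ?addr0 //.
  by move=> l l0; rewrite E0S ?mul0r.
move/eqP: E00; rewrite mulf_eq0 => /orP[/eqP E00|/eqP E00].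
  by left; apply: strict_lower_idem_eq0 => // i j; apply: shift.
right; apply/esym/eqP; rewrite -subr_eq0; apply/eqP.
apply: strict_lower_idem_eq0 => [i j|].
  apply: shift; last by rewrite !mxE eqxx.
  by rewrite mulmxBl mulmxBr mul1mx mulmx1 EJ.
by rewrite mulmxBr mulmx1 mulmxBl mul1mx EE subrr subr0.
Qed.
End NilpotentJordanBlock.

(** * Modules from functors of constant dimension *)

(** A functor from the full subcategory on [P] to vector spaces, with value
[k^n] at every object. Convexity of [P] makes its extension by zero a functor on
the whole category; outside [P] the values of [rmx] are arbitrary. *)
Record constant_rep (C : fincat) (k : fieldType) (P : pred C) (n : nat) :=
  ConstantRep {
    rmx : forall z w : C, hom z w -> 'M[k]_n;
    rmx_convex : forall z w t (g : hom w t) (f : hom z w), P z -> P t -> P w;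
    rmx1 : forall z, P z -> rmx (idm z) = 1%:M;
    rmxM : forall z w t (g : hom w t) (f : hom z w),
      P z -> P w -> P t -> rmx (g \oc f) = rmx g *m rmx f
  }.
Arguments rmx {C k P n} _ {z w} _.

(** The total space of the extension by zero. *)
Definition rep_mod (C : fincat) (k : fieldType) (P : pred C) (n : nat)
  (R : constant_rep k P n) : Type := {ffun {z : C | P z} -> 'cV[k]_n}.

Section RepMod.
Variables (C : fincat) (k : fieldType) (P : pred C) (n : nat).
Variable R : constant_rep k P n.
Local Notation I := {z : C | P z}.
Local Notation M := (rep_mod R).
HB.instance Definition _ := GRing.Zmodule.copy M {ffun I -> 'cV[k]_n}.

Definition rep_scale (a : cat_alg k C) (m : M) : M :=
  [ffun w : I => \sum_(z : I) \sum_(f : hom (val z) (val w))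
     a (Arrow f) *: (rmx R f *m (m : {ffun I -> 'cV[k]_n}) z)].

Fact rep_scaleA a b m : rep_scale a (rep_scale b m) = rep_scale (a * b) m.
Proof.
apply/ffunP => t; rewrite !ffunE.
transitivity (\sum_(w : I) \sum_(g : hom (val w) (val t)) \sum_(z : I)
   \sum_(f : hom (val z) (val w)) (a (Arrow g) * b (Arrow f)) *:
     (rmx R g *m (rmx R f *m (m : {ffun I -> 'cV[k]_n}) z))).
  apply: eq_bigr => w _; apply: eq_bigr => g _; rewrite ffunE mulmx_sumr scaler_sumr.
  apply: eq_bigr => z _; rewrite mulmx_sumr scaler_sumr; apply: eq_bigr => f _.
  by rewrite -scalemxAr scalerA.
under eq_bigr => w _ do rewrite exchange_big.
rewrite exchange_big; apply: eq_bigr => z _ /=.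
transitivity (\sum_(w : C) \sum_(g : hom w (val t)) \sum_(f : hom (val z) w)
  (a (Arrow g) * b (Arrow f)) *:
     (rmx R (g \oc f) *m (m : {ffun I -> 'cV[k]_n}) z)).
  (* intermediate objects outside P contribute nothing, by convexity *)
  rewrite [RHS](bigID P) /= [X in _ + X]big1 ?addr0 => [|w /negP notPw]; last first.
    apply: big1 => g _; apply: big1 => f _; case: notPw.
    exact: (rmx_convex R g f (valP z) (valP t)).
  rewrite [RHS]big_sub; apply: eq_bigr => w _; apply: eq_bigr => g _.
  apply: eq_bigr => f _; rewrite mulmxA (rmxM R) //; exact: valP.
transitivity (\sum_(w : C) \sum_(h : hom (val z) (val t)) \sum_(g : hom w (val t))
  \sum_(f : hom (val z) w | g \oc f == h)
    (a (Arrow g) * b (Arrow f)) *: (rmx R h *m (m : {ffun I -> 'cV[k]_n}) z)).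
  apply: eq_bigr => w _; rewrite [RHS]exchange_big; apply: eq_bigr => g _ /=.
  rewrite [RHS](exchange_big_dep xpredT) //=; apply: eq_bigr => f _.
  by rewrite (big_pred1 (g \oc f)) // => h; rewrite eq_sym.
rewrite exchange_big; apply: eq_bigr => h _ /=.
rewrite cat_alg_mulE scaler_suml; apply: eq_bigr => w _.
by rewrite scaler_suml; apply: eq_bigr => g _; rewrite scaler_suml.
Qed.

Fact rep_scaleDr : right_distributive rep_scale +%R.
Proof.
move=> a m m'; apply/ffunP => w; rewrite !ffunE -big_split; apply: eq_bigr => z _.
by rewrite -big_split; apply: eq_bigr => f _; rewrite ffunE mulmxDr scalerDr.
Qed.

Fact rep_scaleDl m : {morph rep_scale^~ m : a b / a + b}.
Proof.
move=> a b; apply/ffunP => w; rewrite !ffunE -big_split; apply: eq_bigr => z _.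
by rewrite -big_split; apply: eq_bigr => f _; rewrite ffunE scalerDl.
Qed.

Fact rep_scale1 : left_id 1 rep_scale.
Proof.
move=> m; apply/ffunP => w; rewrite ffunE (bigD1 w) //= [X in _ + X]big1 ?addr0.
  rewrite (bigD1 (idm _)) //= big1 ?addr0 => [|f /negPf f1].
    by rewrite cat_alg_oneE eqxx scale1r rmx1 ?mul1mx //; apply: valP.
  by rewrite cat_alg_oneE f1 scale0r.
move=> z zw; apply: big1 => f _; rewrite cat_alg_one_neq ?scale0r //.
Qed.

HB.instance Definition _ := GRing.Zmodule_isLmodule.Build (category_algebra k C) M
  rep_scaleA rep_scale1 rep_scaleDr rep_scaleDl.
End RepMod.

Section RepModElements.
Variables (C : fincat) (k : fieldType) (P : pred C) (n : nat).
Variable R : constant_rep k P n.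
Local Notation I := {z : C | P z}.
Local Notation A := (category_algebra k C).
Local Notation M := (rep_mod R).

Definition fiber (m : M) (z : I) : 'cV[k]_n := (m : {ffun I -> 'cV[k]_n}) z.
Definition at_obj (z : I) (v : 'cV[k]_n) : M := [ffun w => if w == z then v else 0].

Lemma fiberP (m m' : M) : (forall z, fiber m z = fiber m' z) -> m = m'.
Proof. by move=> mm'; apply/ffunP. Qed.

Lemma fiber_sum (T : finType) (F : T -> M) z :
  fiber (\sum_t F t) z = \sum_t fiber (F t) z.
Proof. exact: sum_ffunE. Qed.

Lemma fiber_at_obj w z v : fiber (at_obj z v) w = if w == z then v else 0.
Proof. exact: ffunE. Qed.

Lemma at_obj_sum (m : M) : m = \sum_z at_obj z (fiber m z).
Proof.
apply: fiberP => w; rewrite fiber_sum (bigD1 w) //= big1 ?addr0 => [|z zw].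
  by rewrite fiber_at_obj eqxx.
by rewrite fiber_at_obj eq_sym (negPf zw).
Qed.

Lemma at_objD z u v : at_obj z (u + v) = at_obj z u + at_obj z v.
Proof.
by apply/ffunP => w; rewrite !ffunE; case: ifP => // _; rewrite addr0.
Qed.

Lemma at_obj0 z : at_obj z 0 = 0.
Proof. by apply/ffunP => w; rewrite !ffunE if_same. Qed.

Lemma basis_act (z w : I) (f : hom (val z) (val w)) (m : M) :
  (basis_elt k (Arrow f) : A) *: m = at_obj w (rmx R f *m fiber m z).
Proof.
have neqA (a b : arrow C) : tag a != tag b -> (a == b) = false.
  by move=> ab; apply: contraNF ab => /eqP->.
apply: fiberP => w'; rewrite fiber_at_obj [LHS]ffunE.
have [->|nw] := eqVneq w' w; last first.
  rewrite big1 // => z' _; rewrite big1 // => f' _; rewrite ffunE.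
  by rewrite neqA ?scale0r //= xpair_eqE negb_and orbC (inj_eq val_inj) nw.
rewrite (bigD1 z) //= [X in _ + X]big1 ?addr0 => [|z' nz]; last first.
  rewrite big1 // => f' _; rewrite ffunE neqA ?scale0r //= xpair_eqE negb_and.
  by rewrite (inj_eq val_inj) nz.
rewrite (bigD1 f) //= big1 ?addr0 => [|f' /negPf nf].
  by rewrite ffunE eqxx scale1r.
by rewrite ffunE arrow_eqE nf scale0r.
Qed.

Lemma idm_act (w : I) (m : M) :
  (basis_elt k (Arrow (idm (val w))) : A) *: m = at_obj w (fiber m w).
Proof. by rewrite basis_act rmx1 ?mul1mx //; apply: valP. Qed.

Lemma fiber_scal c (m : M) z : fiber (alg_scal A c *: m) z = c *: fiber m z.
Proof.
rewrite -[in RHS](@scale1r A M m) /fiber.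
rewrite [in LHS]ffunE [in RHS]ffunE scaler_sumr; apply: eq_bigr => w _.
rewrite scaler_sumr; apply: eq_bigr => f _.
by rewrite scalerA; congr (_ *: _); apply: ffunE.
Qed.

Lemma at_objZ z c v : at_obj z (c *: v) = alg_scal A c *: at_obj z v.
Proof.
apply: fiberP => w; rewrite fiber_scal !fiber_at_obj.
by case: ifP => // _; rewrite scaler0.
Qed.

Lemma at_obj_delta z v :
  at_obj z v = \sum_j alg_scal A (v j 0) *: at_obj z (delta_mx j 0).
Proof.
under eq_bigr => j _ do rewrite -at_objZ.
rewrite -(big_morph _ (at_objD z) (at_obj0 z)); congr at_obj.
by rewrite {1}[v]matrix_sum_delta; apply: eq_bigr => j _; rewrite big_ord1.
Qed.

Lemma rep_mod_findim : findim_module (M : lmodType A).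
Proof.
apply: (@findim_module_family _ _ _ (I * 'I_n)%type
  (fun t => at_obj t.1 (delta_mx t.2 0) : M)
  (fun m t => fiber m t.1 t.2 0)) => m.
rewrite -(pair_bigA _ (fun z j => alg_scal A (fiber m z j 0)
  *: (at_obj z (delta_mx j 0) : M))) /=.
by rewrite {1}[m]at_obj_sum; apply: eq_bigr => z _; apply: at_obj_delta.
Qed.
End RepModElements.

Lemma mulmx_col_inj (F : fieldType) (m n : nat) (X Y : 'M[F]_(m, n)) :
  (forall v : 'cV_n, X *m v = Y *m v) -> X = Y.
Proof.
move=> XY; apply/matrixP => i j.
by have /colP/(_ i) := XY (delta_mx j 0); rewrite -!colE !mxE.
Qed.

Section RepModMorphism.
Variables (C : fincat) (k : fieldType) (P : pred C).
Local Notation I := {z : C | P z}.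
Local Notation A := (category_algebra k C).
Local Notation Mod R := (rep_mod R : lmodType A).
Implicit Types z w : I.

Definition fiber_mx (n m : nat) (R : constant_rep k P n) (S : constant_rep k P m)
    (phi : Mod R -> Mod S) (z : I) : 'M[k]_(m, n) :=
  \matrix_(i, j) fiber (phi (at_obj R z (delta_mx j 0))) z i 0.

Section OneMorphism.
Variables (n m : nat) (R : constant_rep k P n) (S : constant_rep k P m).
Variable phi : {linear Mod R -> Mod S}.

(** Linearity over the identity of [z] forces a morphism to preserve the summand
at [z], on which it is given by a matrix. *)
Lemma fiber_mxE z v : phi (at_obj R z v) = at_obj S z (fiber_mx phi z *m v).
Proof.
have phi_z u : phi (at_obj R z u) = at_obj S z (fiber (phi (at_obj R z u)) z).
  rewrite -[in RHS]idm_act -linearZ_LR idm_act.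
  by rewrite fiber_at_obj eqxx.
rewrite [in LHS]at_obj_delta linear_sum.
have -> : fiber_mx phi z *m v =
    \sum_j v j 0 *: fiber (phi (at_obj R z (delta_mx j 0))) z.
  apply/matrixP => i j; rewrite mxE summxE ord1; apply: eq_bigr => l _.
  by rewrite !mxE mulrC.
rewrite (big_morph _ (at_objD S z) (at_obj0 S z)); apply: eq_bigr => j _.
by rewrite linearZ_LR [in LHS]phi_z at_objZ.
Qed.

Lemma at_obj_inj z : injective (at_obj S z).
Proof.
by move=> u v /(congr1 (fun x => fiber x z)); rewrite !fiber_at_obj eqxx.
Qed.

Lemma fiber_mx_natural z w (f : hom (val z) (val w)) :
  fiber_mx phi w *m rmx R f = rmx S f *m fiber_mx phi z.
Proof.
apply: mulmx_col_inj => v; apply: (@at_obj_inj w); rewrite -!mulmxA -fiber_mxE.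
have act n' (R' : constant_rep k P n') u : at_obj R' w (rmx R' f *m u) =
    (basis_elt k (Arrow f) : A) *: (at_obj R' z u : Mod R').
  by rewrite basis_act fiber_at_obj eqxx.
by rewrite !act linearZ_LR fiber_mxE.
Qed.
End OneMorphism.

Lemma fiber_mx_comp n m l (R : constant_rep k P n) (S : constant_rep k P m)
    (T : constant_rep k P l) (psi : {linear Mod S -> Mod T})
    (phi : {linear Mod R -> Mod S}) z :
  fiber_mx (psi \o phi) z = fiber_mx psi z *m fiber_mx phi z.
Proof.
apply: mulmx_col_inj => v; apply: (@at_obj_inj _ T z).
by rewrite -mulmxA -!fiber_mxE.
Qed.

Lemma fiber_mx_id n (R : constant_rep k P n) (phi : Mod R -> Mod R) z :
  phi =1 id -> fiber_mx phi z = 1%:M.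
Proof.
move=> phi1; apply/matrixP => i j.
by rewrite mxE phi1 fiber_at_obj eqxx !mxE eqxx andbT.
Qed.

Lemma fiber_mx_inj n m (R : constant_rep k P n) (S : constant_rep k P m)
    (phi psi : {linear Mod R -> Mod S}) :
  (forall z, fiber_mx phi z = fiber_mx psi z) -> phi =1 psi.
Proof.
move=> phi_psi v; rewrite [v]at_obj_sum !linear_sum.
by apply: eq_bigr => z _; rewrite !fiber_mxE phi_psi.
Qed.

(** [z] only witnesses that the support is nonempty. *)
Lemma isomorphic_rep_dim n m (R : constant_rep k P n) (S : constant_rep k P m) z :
  module_isomorphic (Mod R) (Mod S) -> n = m.
Proof.
case=> f [g fK gK].
pose gL : {linear Mod S -> Mod R} := HB.pack_for {linear Mod S -> Mod R} g
   (GRing.isLinear.Build _ _ _ _ g (can2_linear fK gK)).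
have fg : fiber_mx f z *m fiber_mx gL z = 1%:M.
  by rewrite -fiber_mx_comp; apply: fiber_mx_id => v; apply: gK.
have gf : fiber_mx gL z *m fiber_mx f z = 1%:M.
  by rewrite -fiber_mx_comp; apply: fiber_mx_id => v; apply: fK.
by apply/eqP; rewrite eqn_leq (mulmx1_min gf) (mulmx1_min fg).
Qed.

End RepModMorphism.

(** * Parallel morphisms in the representation-finite case *)

Lemma etriv_endo (C : fincat) (x : C) (f g : hom x x) : etriv f g.
Proof.
apply: connect1; apply/etriv1P; exists x, (idm x), (idm x), f, g.
by rewrite !comp1m !compm1.
Qed.

Lemma etriv_post_endo (C : fincat) (x y : C) (h : hom y y) (f : hom x y) :
  etriv (h \oc f) f.
Proof. by rewrite -[f in etriv _ f]comp1m; apply/etriv_compr/etriv_endo. Qed.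

Lemma etriv_pre_endo (C : fincat) (x y : C) (f : hom x y) (h : hom x x) :
  etriv (f \oc h) f.
Proof. by rewrite -[f in etriv _ f]compm1; apply/etriv_compl/etriv_endo. Qed.

Definition directed (C : fincat) : Prop :=
  forall x y : C, hom x y -> hom y x -> x = y.

Lemma EI_skeletal_directed (C : fincat) :
  EI_category C -> skeletal C -> directed C.
Proof.
move=> hEI hsk x y f g; apply: hsk; exists f.
have [u [ugf _]] := hEI _ (g \oc f); have [v [_ fgv]] := hEI _ (f \oc g).
exists (u \oc g); split; first by rewrite -compA.
suff -> : u \oc g = g \oc v by rewrite compA.
by rewrite -[u \oc g]compm1 -fgv !compA -(compA u g f) ugf comp1m.
Qed.

Section Kronecker.
Variables (C : fincat) (k : fieldType) (C_dir : directed C).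
Variables (x y : C) (f0 f1 : hom x y).
Hypothesis f01 : ~~ etriv f0 f1.
Hypothesis y_min :
  forall z (h : hom z y), z != y -> forall g g' : hom x z, etriv g g'.

Let interval : pred C := fun z => (0 < #|hom x z|)%N && (0 < #|hom z y|)%N.

Lemma intervalP z : reflect (inhabited (hom x z) /\ inhabited (hom z y)) (interval z).
Proof.
apply: (iffP andP) => [[/card_gt0P[g _] /card_gt0P[h _]]|[[g] [h]]].
  by split; constructor.
by split; apply/card_gt0P; [exists g|exists h].
Qed.

(** The class of [f0], as a predicate on arrows with arbitrary ends: this avoids
transporting a morphism [z -> w] along an equation [w = y]. *)
Definition in_class0 (a : arrow C) : bool :=
  [exists p : hom x y, (a == Arrow p) && etriv f0 p].

Lemma in_class0E (p : hom x y) : in_class0 (Arrow p) = etriv f0 p.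
Proof.
apply/existsP/idP => [[q /andP[]]|f0p].
  by rewrite arrow_eqE => /eqP->.
by exists p; rewrite eqxx.
Qed.

(** The morphisms on which the Kronecker module acts by the Jordan block. By
minimality of [y], the quantifier over [g] could as well be existential when [z]
is in the interval. *)
Definition twisted (z w : C) (f : hom z w) : bool :=
  [&& z != y, w == y & [forall g : hom x z, ~~ in_class0 (Arrow (f \oc g))]].

Lemma x_neq_y : x != y.
Proof.
apply: contraNneq f01 => xy; move: f0 f1; rewrite -xy => f f'.
exact: etriv_endo.
Qed.

Lemma twisted_f0 : ~~ twisted f0.
Proof.
rewrite /twisted !negb_and; apply/orP; right; apply/orP; right.
rewrite negb_forall; apply/existsP; exists (idm x).
by rewrite compm1 in_class0E etriv_refl.
Qed.

Lemma twisted_f1 : twisted f1.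
Proof.
rewrite /twisted x_neq_y eqxx; apply/forallP => g; rewrite in_class0E.
by apply: contra f01 => f0f1g; apply: etriv_trans f0f1g (etriv_pre_endo f1 g).
Qed.

(** A composite is twisted when one of its factors is, and they are never both
twisted: this is functoriality of [kronecker_mx]. If the middle object is [y],
then [g] is an endomorphism of [y] and does not change classes; otherwise all
morphisms from [x] to the middle object are equivalent. *)
Lemma twisted_comp z w t (g : hom w t) (f : hom z w) :
  interval z -> interval w -> interval t ->
  ~~ (twisted g && twisted f) /\ twisted (g \oc f) = twisted g || twisted f.
Proof.
move=> /intervalP[[gz] [hz]] /intervalP[[gw] [hw]] /intervalP[[gt] [ht]].
have [wy|nwy] := eqVneq w y.
  have ty : t = y by apply: C_dir ht _; rewrite -wy.
  subst w t; rewrite {1 3}/twisted eqxx /=; split=> //.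
  rewrite /twisted eqxx; congr (_ && _); apply: eq_forallb => e.
  rewrite !in_class0E -compA; congr (~~ _).
  by apply/idP/idP => /etriv_trans; apply;
     [|rewrite etriv_sym]; apply: etriv_post_endo.
have -> : twisted f = false by rewrite /twisted (negPf nwy) andbF.
rewrite andbF orbF; split=> //; rewrite /twisted nwy.
have -> /= : z != y.
  by apply: contraNneq nwy => zy; apply/eqP; apply: C_dir hw _; rewrite -zy.
have [ty|//] := eqVneq t y; subst t => /=.
apply/forallP/forallP => all0 e; last by rewrite -compA.
have := all0 gz; rewrite -compA !in_class0E; apply: contra => f0e.
apply: etriv_trans f0e _; apply: etriv_compl; exact: y_min.
Qed.

Section Dimension.
Variable n : nat.

Definition kronecker_mx (z w : C) (f : hom z w) : 'M[k]_n.+1 :=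
  if twisted f then jordan0 k n else 1%:M.

Fact kronecker_convex z w t (g : hom w t) (f : hom z w) :
  interval z -> interval t -> interval w.
Proof.
move=> /intervalP[[gz] _] /intervalP[_ [ht]]; apply/intervalP.
by split; constructor; [exact: (f \oc gz) | exact: (ht \oc g)].
Qed.

Fact kronecker_mx1 z : interval z -> kronecker_mx (idm z) = 1%:M.
Proof. by move=> _; rewrite /kronecker_mx /twisted; case: (z == y). Qed.

Fact kronecker_mxM z w t (g : hom w t) (f : hom z w) :
  interval z -> interval w -> interval t ->
  kronecker_mx (g \oc f) = kronecker_mx g *m kronecker_mx f.
Proof.
move=> Iz Iw It; have [] := twisted_comp g f Iz Iw It.
rewrite /kronecker_mx => + ->.
by case: (twisted g); case: (twisted f); rewrite //= ?mul1mx ?mulmx1.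
Qed.

Definition kronecker : constant_rep k interval n.+1 :=
  ConstantRep kronecker_convex kronecker_mx1 kronecker_mxM.

Local Notation A := (category_algebra k C).
Local Notation M := (rep_mod kronecker : lmodType A).

Fact interval_x : interval x.
Proof. by apply/intervalP; split; constructor; [exact: idm|exact: f0]. Qed.
Fact interval_y : interval y.
Proof. by apply/intervalP; split; constructor; [exact: f0|exact: idm]. Qed.
Let ox : {z | interval z} := exist _ x interval_x.
Let oy : {z | interval z} := exist _ y interval_y.

(** Every object of the interval is reached from [x] by an untwisted morphism,
which acts as the identity: [f0] for [y], any morphism for the others. The
twisted morphism [f1] gives commutation with the Jordan block. *)
Lemma kronecker_endo (e : {linear M -> M}) z :
  fiber_mx e z = fiber_mx e ox
  /\ fiber_mx e ox *m jordan0 k n = jordan0 k n *m fiber_mx e ox.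
Proof.
have untw (w : {z | interval z}) (f : hom x (val w)) :
    ~~ twisted f -> fiber_mx e w = fiber_mx e ox.
  move=> f_untw; have := fiber_mx_natural e (z := ox) (w := w) f.
  by rewrite /= /kronecker_mx (negPf f_untw) mulmx1 mul1mx.
have exy := untw oy f0 twisted_f0.
split; last first.
  have := fiber_mx_natural e (z := ox) (w := oy) f1.
  by rewrite /= /kronecker_mx twisted_f1 exy.
have [zy|nzy] := eqVneq (val z) y.
  by have -> : z = oy by apply: val_inj.
have [[f] _] := intervalP _ (valP z); apply: (untw z f).
by rewrite /twisted (negPf nzy) /= andbF.
Qed.

Lemma kronecker_indecomposable : indecomposable M.
Proof.
apply: indecomposable_idem => [M0|e ee].
  have := M0 (at_obj kronecker ox (delta_mx 0 0)).
  rewrite -(at_obj0 kronecker ox) => /at_obj_inj/matrixP/(_ 0 0)/eqP.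
  by rewrite !mxE oner_eq0.
have EE : fiber_mx e ox *m fiber_mx e ox = fiber_mx e ox.
  rewrite -fiber_mx_comp; apply/matrixP => i j; rewrite !mxE.
  by have -> := ee (at_obj kronecker ox (delta_mx j 0)).
have EJ := (kronecker_endo e ox).2.
have [E0|E1] := jordan0_commute_idem EJ EE; [left|right].
  apply: (fiber_mx_inj (psi := \0)) => z; rewrite (kronecker_endo e z).1 E0.
  by apply/matrixP => i j; rewrite !mxE [fiber _ _]ffunE mxE.
apply: (fiber_mx_inj (psi := idfun)) => z.
by rewrite (kronecker_endo e z).1 E1 fiber_mx_id.
Qed.
End Dimension.

Lemma kronecker_infinite : ~ finite_rep_type k C.
Proof.
case=> N [M M_all].
have [i Mi] : exists i : 'I_N.+1 -> 'I_N, forall n : 'I_N.+1,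
    module_isomorphic (rep_mod (kronecker n) : lmodType (category_algebra k C))
                      (M (i n)).
  apply: (@fin_all_exists _ (fun=> 'I_N) (fun (n : 'I_N.+1) j => module_isomorphic
    (rep_mod (kronecker n) : lmodType (category_algebra k C)) (M j))) => n.
  apply: M_all; [exact: rep_mod_findim|exact: kronecker_indecomposable].
have i_inj : injective i.
  move=> n m inm; apply: val_inj; apply: succn_inj.
  apply: (@isomorphic_rep_dim C k interval n.+1 m.+1 (kronecker n) (kronecker m)
           (exist _ x interval_x)).
  apply: module_isomorphic_trans (Mi n) _; rewrite inm.
  exact/module_isomorphic_sym.
by have := leq_card i i_inj; rewrite !card_ord ltnn.
Qed.
End Kronecker.

(** Among the objects with inequivalent morphisms from [x], take one with the
fewest objects below it: objects strictly below it have fewer still, by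
directedness. *)
Lemma finite_rep_type_etriv (C : fincat) (k : fieldType) :
  directed C -> finite_rep_type k C ->
  forall (x y : C) (f g : hom x y), etriv f g.
Proof.
move=> C_dir Cfin x y f g; apply: contraTT isT => fg.
pose bad (w : C) := [exists p : hom x w, exists q : hom x w, ~~ etriv p q].
pose down (w : C) := #|[set z : C | (0 < #|hom z w|)%N]|.
have bad_y : bad y by apply/existsP; exists f; apply/existsP; exists g.
have [w /existsP[p /existsP[q pq]] w_min] := arg_minnP down bad_y.
case: (@kronecker_infinite C k C_dir x w p q pq _ Cfin) => z h zw r r'.
apply: contraTT isT => rr'.
have bad_z : bad z by apply/existsP; exists r; apply/existsP; exists r'.
have := w_min z bad_z; rewrite leqNgt => /negP[]; apply: proper_card.
apply/properP; split.
  apply/subsetP => t; rewrite !inE => /card_gt0P[u _].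
  by apply/card_gt0P; exists (h \oc u).
exists w; rewrite !inE.
  by apply/card_gt0P; exists (idm w).
by apply: contraNN zw => /card_gt0P[u _]; apply/eqP/C_dir.
Qed.

(** * The poset of objects *)

Section HomPoset.
Variables (C : fincat) (C_dir : directed C).

Definition hom_order & directed C : Type := C.
Local Notation P := (hom_order C_dir).
HB.instance Definition _ := Finite.on P.

Definition hom_le : rel P := fun x y => (0 < #|@hom C x y|)%N.

Fact hom_le_refl : reflexive hom_le.
Proof. by move=> x; apply/card_gt0P; exists (idm (x : C)). Qed.
Fact hom_le_anti : antisymmetric hom_le.
Proof. by move=> x y /andP[/card_gt0P[f _] /card_gt0P[g _]]; apply: C_dir. Qed.
Fact hom_le_trans : transitive hom_le.
Proof.
move=> y x z /card_gt0P[f _] /card_gt0P[g _].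
by apply/card_gt0P; exists (comp g f).
Qed.

HB.instance Definition _ := Order.Le_isPOrder.Build (Order.Disp tt tt) P
  hom_le_refl hom_le_anti hom_le_trans.

Lemma hom_hom_le (x y : P) : @hom C x y -> (x <= y)%O.
Proof. by move=> f; apply/card_gt0P; exists f. Qed.
End HomPoset.

Theorem corollary2p8 (C : fincat) (k : fieldType)
    (hEI : EI_category C) (hsk : skeletal C) (hfin : finite_rep_type k C) :
  exists (d : Order.disp_t) (P : finPOrderType d),
    cat_isomorphic (endotriv C) (poset_cat P) /\ finite_rep_type k (poset_cat P).
Proof.
have C_dir := EI_skeletal_directed hEI hsk.
have C_thin := finite_rep_type_etriv C_dir hfin.
pose P : finPOrderType _ := hom_order C_dir.
exists _, P; split.
  pose Fm (x y : endotriv C) (u : hom x y) : @poset_hom _ P x y :=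
    exist _ tt (@hom_hom_le C C_dir x y (et_repr u)).
  exists (id : endotriv C -> poset_cat P), Fm; split=> // [x|x y z g f||x y].
  - exact: poset_hom_irr.
  - exact: poset_hom_irr.
  - by exists id.
  apply: inj_card_bij => [u v _|].
    by rewrite -[u]et_reprK -[v]et_reprK; apply/et_piP.
  have [xy|/card_gt0P[p _]] := posnP #|@poset_hom _ P x y|.
    by rewrite xy.
  have /card_gt0P[f _] : (0 < #|@hom C x y|)%N by have := valP p.
  apply: (@leq_trans 1); last by apply/card_gt0P; exists (et_pi f).
  by apply/card_le1_eqP => q r _ _; apply: poset_hom_irr.
apply: (@finite_rep_type_full k C (poset_cat P) id
  (fun x y f => exist _ tt (@hom_hom_le C C_dir x y f))) hfin => //.
- by move=> x; apply: poset_hom_irr.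
- by move=> *; apply: poset_hom_irr.
- by exists id.
move=> x y g; have /card_gt0P[f _] : (0 < #|@hom C x y|)%N by have := valP g.
by exists f; apply: poset_hom_irr.
Qed.
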